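(* Let $n\ge1$ and let $\alpha=\sum_{i=1}^n a^{(i)}\,dx_i$ be a 1-form with coefficients $a^{(i)}\in\mathbb{C}(x_1,\ldots,x_n)$. If $\alpha$ is closed, i.e. $d\alpha=0$, then there exist (finitely many) elements $g,f,f_i\in\mathbb{C}[x_1,\ldots,x_n]$, with $f$ and all $f_i$ nonzero, and constants $a_i\in\mathbb{C}$ such that $$\alpha=d\left(\frac{g}{f}\right)+\sum_i a_i\frac{df_i}{f_i}.$$
   Context: Here $d$ is the usual exterior derivative on differential forms in $dx_1,\ldots,dx_n$ with coefficients in the rational function field $\mathbb{C}(x_1,\ldots,x_n)$, with derivations $\partial/\partial x_1,\ldots,\partial/\partial x_n$. *)

(* Defs.v *)
From HB Require Import structures.
From mathcomp Require Import all_boot all_order all_algebra fraction.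
From mathcomp Require Import generic_quotient.
From mathcomp Require Import mpoly ring.
From mathcomp Require Import reals complex.

Set Implicit Arguments.
Unset Strict Implicit.
Unset Printing Implicit Defensive.

Import GRing.Theory.
Local Open Scope ring_scope.

Notation ratfun K n := {fraction {mpoly K[n]}}.

Notation "p %:F" := (@FracField.tofrac _ p) : ring_scope.

(* The derivation d/dx_i of K(x_1, ..., x_n): the quotient rule applied to the
   representative numerator and denominator of x. [partialE] shows that any
   other representative gives the same result. *)
Definition partial (K : fieldType) (n : nat) (i : 'I_n) (x : ratfun K n) :
    ratfun K n :=
  let p := \n_(repr x) in let q := \d_(repr x) in
  (mderiv i p * q - p * mderiv i q)%:F / (q ^+ 2)%:F.

(* Differential forms, all degrees together: w S is the coefficient in w of
   dx_S = dx_(s_1) /\ ... /\ dx_(s_k), where S = {s_1 < ... < s_k}. The regular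
   module ^o makes forms a vector space over the rational functions. *)
Notation dform K n := {ffun {set 'I_n} -> (ratfun K n)^o}.

Definition dxs (K : fieldType) (n : nat) (S : {set 'I_n}) : dform K n :=
  [ffun T => (T == S)%:R].

Definition dx (K : fieldType) (n : nat) (i : 'I_n) : dform K n :=
  dxs K [set i].

Definition form0 (K : fieldType) (n : nat) (x : ratfun K n) : dform K n :=
  x *: dxs K set0.

(* d w = \sum_i dx_i /\ (d w / dx_i), where for i \notin S
   dx_i /\ dx_S = (-1) ^ #{j in S | j < i} dx_(i |: S),
   and dx_i /\ dx_S = 0 for i \in S. *)
Definition extd (K : fieldType) (n : nat) (w : dform K n) : dform K n :=
  [ffun S : {set 'I_n} =>
     \sum_(i in S) (-1) ^+ #|[set j in S | (j < i)%N]| * partial i (w (S :\ i))].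

Section Facts.
Variables (K : fieldType) (n : nat).
Implicit Types (p q : {mpoly K[n]}) (x y : ratfun K n) (i j : 'I_n).

Lemma fracE x : x = (\n_(repr x))%:F / (\d_(repr x))%:F.
Proof.
have d0 := denom_ratioP (repr x).
apply: (canRL (mulfK _)); first by rewrite tofrac_eq0.
rewrite -{1}[x]reprK; move: (repr x) d0 => [[a b] /= b0] _.
rewrite !piE; apply/eqmodP => /=; rewrite FracField.equivfE /FracField.mulf.
by rewrite !numden_Ratio ?oner_neq0 ?mulr1 ?mulf_neq0 ?oner_neq0 // mulrC.
Qed.

Lemma partialE i p q : q != 0 ->
  partial i (p%:F / q%:F) =
  (mderiv i p * q - p * mderiv i q)%:F / (q ^+ 2)%:F.
Proof.
move=> q0; rewrite /partial; set x := p%:F / q%:F.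
have d0 : \d_(repr x) != 0 := denom_ratioP _.
have /eqP := fracE x; rewrite {1}/x eqr_div ?tofrac_eq0 // -!rmorphM /=.
rewrite tofrac_eq; move: (\n_(repr x)) (\d_(repr x)) d0 => a b b0 /eqP e.
have e' : mderiv i (p * b) = mderiv i (a * q) by rewrite e.
rewrite !mderivM in e'.
apply/eqP; rewrite eqr_div ?tofrac_eq0 ?expf_neq0 // -!rmorphM /= tofrac_eq.
rewrite -subr_eq0; apply/eqP.
move: (mderiv i p) (mderiv i q) (mderiv i a) (mderiv i b) e' => p' q' a' b' e'.
have -> : (a' * b - a * b') * q ^+ 2 - (p' * q - p * q') * b ^+ 2 =
  (a' * q + a * q' - (p' * b + p * b')) * (b * q)
  + (p * b - a * q) * (b' * q + q' * b) by ring.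
have -> : a' * q + a * q' - (p' * b + p * b') = 0 by rewrite e' subrr.
by rewrite e subrr !mul0r addr0.
Qed.

Lemma partial0 i : partial i (0 : ratfun K n) = 0.
Proof.
have -> : (0 : ratfun K n) = 0%:F / 1%:F by rewrite tofrac0 mul0r.
by rewrite partialE ?oner_neq0 // mderiv0 !mul0r subrr tofrac0 !mul0r.
Qed.

Lemma extd_form0 x : extd (form0 x) = \sum_(i < n) partial i x *: dx K i.
Proof.
apply/ffunP => S; rewrite !ffunE sum_ffunE.
have pE (i : 'I_n) : i \in S ->
    partial i (form0 x (S :\ i)) = (S == [set i])%:R * partial i x.
  move=> iS; rewrite !ffunE.
  have -> : (S :\ i == set0) = (S == [set i]).
    by rewrite -[LHS]subset0 subDset setU0 eqEsubset sub1set iS andbT.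
  by case: (S == _); rewrite ?mul1r ?mul0r /GRing.scale/= ?mulr1 // mulr0 partial0.
rewrite [RHS](bigID (mem S)) /= [X in _ + X]big1 ?addr0; last first.
  move=> i iS; rewrite !ffunE; case: eqP => [E|_]; last exact: mulr0.
  by rewrite E set11 in iS.
apply: eq_bigr => i iS; rewrite pE // !ffunE /GRing.scale /= mulrA mulrC.
case: eqP => [->|_]; last by rewrite mulr0 mulr0.
rewrite (_ : [set j in _ | _] = set0) ?cards0 ?expr0 ?mulr1 //.
by apply/setP => j; rewrite !inE; case: eqP => // ->; rewrite ltnn.
Qed.

Lemma sum_dxE (a : 'I_n -> ratfun K n) (S : {set 'I_n}) :
  (\sum_(i < n) a i *: dx K i) S = \sum_(i < n | S == [set i]) a i.
Proof.
rewrite sum_ffunE [RHS]big_mkcond; apply: eq_bigr => i _.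
by rewrite !ffunE; case: ifP => _; [exact: mulr1 | exact: mulr0].
Qed.

Lemma extd_form1_eq0 (a : 'I_n -> ratfun K n) :
  extd (\sum_(i < n) a i *: dx K i) = 0 <->
  (forall i j, partial i (a j) = partial j (a i)).
Proof.
have aE i : (\sum_(i < n) a i *: dx K i) [set i] = a i.
  rewrite sum_dxE (big_pred1 i) // => j /=.
  by rewrite (inj_eq set1_inj) eq_sym.
have d2 i j : (i < j)%N -> extd (\sum_(i < n) a i *: dx K i) [set i; j] =
    partial i (a j) - partial j (a i).
  move=> ij; have nij : i != j by rewrite neq_ltn ij.
  rewrite ffunE big_setU1 ?inE //= big_set1.
  have -> : [set i; j] :\ i = [set j] by rewrite setU1K ?inE.
  have -> : [set i; j] :\ j = [set i] by rewrite setUC setU1K ?inE // eq_sym.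
  rewrite !aE (_ : [set _ in _ | (_ < i)%N] = set0) ?cards0 ?expr0 ?mul1r.
    rewrite (_ : [set _ in _ | _] = [set i]) ?cards1 ?expr1 ?mulN1r //.
    apply/setP => k; rewrite !inE.
    by case: (eqVneq k i) => [->|_] //=; case: eqP => // ->; rewrite ltnn.
  apply/setP => k; rewrite !inE.
  case: (eqVneq k i) => [->|_] /=; first by rewrite ltnn.
  by case: eqP => // ->; rewrite ltnNge ltnW.
split=> [d0 i j|sym].
  wlog ij : i j / (i < j)%N => [W|].
    by case: (ltngtP i j) => [/W//|/W//|/val_inj->].
  by apply/eqP; rewrite -subr_eq0 -d2 // d0 ffunE.
apply/ffunP => S; rewrite [RHS]ffunE.
have [/cards2P[i [j [nij ->]]]|S2] := boolP (#|S| == 2%N).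
  wlog ij : i j nij / (i < j)%N => [W|].
    have := nij; rewrite neq_ltn => /orP[/W->//|/W]; rewrite setUC => -> //.
    by rewrite eq_sym.
  by rewrite d2 // sym subrr.
rewrite ffunE big1 // => i iS; rewrite sum_dxE big_pred0 ?partial0 ?mulr0 //.
move=> j; apply: contraNF S2 => /eqP E.
by rewrite (cardsD1 i) iS E cards1.
Qed.

End Facts.

(* Main.v *)
(* Induct on the number of variables, integrating the dx_k-coefficient h of the
   form, viewed in L(x) with x = x_k and L = C(x_1, ..., x_(k-1)). Closedness
   says that the derivative of h along each other variable is exact in x. By
   Hermite reduction h is, modulo d/dx-exact functions, a sum of simple poles
   t q'/q with q irreducible over L, and closedness makes t modulo q a constant
   of the field L[x]/q. The minimal polynomial over L of such an element has
   constant coefficients, so t is a complex number modulo q and the pole is a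
   multiple of the logarithmic derivative of q. Subtracting the form so obtained
   removes dx_k, and by closedness x_k disappears from the other coefficients. *)

Require Import Defs.
From HB Require Import structures.
From mathcomp Require Import all_boot all_order all_algebra fraction.
From mathcomp Require Import mpoly ring.
From mathcomp Require Import boolp reals complex.

Set Implicit Arguments.
Unset Strict Implicit.
Unset Printing Implicit Defensive.

Import GRing.Theory.
Local Open Scope ring_scope.

(** * Polynomials over a field *)

Section Polynomials.
Variable L : fieldType.
Implicit Types (p q r D : {poly L}).

Lemma exists_irreducible_dvdp D :
  (1 < size D)%N -> exists2 q, irreducible_poly q & q %| D.
Proof.
have [n] := ubnP (size D); elim: n D => // n IHn D leDn D1.
have D0 : D != 0 by rewrite -size_poly_gt0 ltnW.
case: (pselect (exists p, [/\ size p != 1, p %| D & ~~ (p %= D)])); last first.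
  move=> nD; exists D => //; split=> // p p1 pD.
  by apply: contrapT => /negP npD; apply: nD; exists p.
case=> p [p1 pD npD]; have p0 : p != 0 by apply: dvdpN0 pD D0.
have [||q qI qp] := IHn p.
- rewrite ltnS in leDn; apply: leq_trans leDn; rewrite ltn_neqAle dvdp_leq // andbT.
  by rewrite dvdp_size_eqp.
- by rewrite ltn_neqAle eq_sym p1 size_poly_gt0.
by exists q => //; apply: dvdp_trans pD.
Qed.

Lemma irreducible_dvdpM q p r :
  irreducible_poly q -> q %| p * r -> (q %| p) || (q %| r).
Proof.
move=> qI; have [//|nqp] := boolP (q %| p).
by rewrite Gauss_dvdpr // irreducible_poly_coprime.
Qed.

Lemma irreducible_dvdpX q p m :
  irreducible_poly q -> q %| p ^+ m -> q %| p.
Proof.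
move=> qI; elim: m => [|m IHm]; last first.
  by rewrite exprS => /(irreducible_dvdpM qI)/orP[].
by rewrite expr0 dvdp1 => /eqP q1; have := qI.1; rewrite q1.
Qed.

Lemma bezout_irreducible q p r :
  irreducible_poly q -> ~~ (q %| p) -> exists s t, r = s * q + t * p.
Proof.
move=> qI; rewrite -irreducible_poly_coprime // => /Bezout_eq1_coprimepP[[u v]] /= e.
by exists (r * u), (r * v); rewrite -!mulrA -mulrDr e mulr1.
Qed.

Lemma irreducible_valuation q D : irreducible_poly q -> D != 0 ->
  exists m E, D = q ^+ m * E /\ ~~ (q %| E).
Proof.
move=> qI; have [n] := ubnP (size D); elim: n D => // n IHn D leDn D0.
have [/dvdpP[E DE]|nqD] := boolP (q %| D); last by exists 0, D; rewrite mul1r.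
have E0 : E != 0 by apply: contraNneq D0 => E0; rewrite DE E0 mul0r.
have ltED : (size E < n)%N.
  rewrite ltnS in leDn; apply: leq_trans leDn.
  rewrite DE size_mul ?(irredp_neq0 qI) //; have := qI.1.
  by case: (size q) => [|[|k]] // _; rewrite !addnS /= ltnS leq_addr.
have [m [E' [EE nqE']]] := IHn E ltED E0.
by exists m.+1, E'; rewrite exprSr mulrAC -EE.
Qed.

(** The classes of [1, r, ..., r ^+ d], with [d] the degree of [q], are [d + 1] vectors in the
    [d]-dimensional space [L[x]/q]; a linear relation between them gives [M]. *)
Lemma exists_annihilator_mod q r :
  q != 0 -> exists2 M : {poly L}, M != 0 & q %| M \Po r.
Proof.
move=> q0; pose d := (size q).-1.
have szq : size q = d.+1 by rewrite prednK // size_poly_gt0.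
pose A := \matrix_(j < d.+1) (poly_rV ((r ^+ j) %% q) : 'rV[L]_d).
have : kermx A != 0.
  rewrite -mxrank_eq0 mxrank_ker -lt0n subn_gt0 ltnS; exact: rank_leq_col.
case/rowV0Pn=> v /sub_kermxP vA v0.
have sz j : (size (r ^+ j %% q)%R <= d)%N by rewrite -ltnS -szq ltn_modp.
have e : \sum_(j < d.+1) v 0 j *: (r ^+ j %% q) = 0.
  have /(congr1 rVpoly) := vA; rewrite mulmx_sum_row linear0 linear_sum /=; apply: etrans.
  by apply: eq_bigr => j _; rewrite linearZ /= rowK poly_rV_K.
exists (\sum_(j < d.+1) v 0 j *: 'X^j).
  apply: contraNneq v0 => M0; apply/eqP/rowP => i; rewrite mxE.
  have := congr1 (fun p : {poly L} => p`_i) M0.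
  rewrite coef0 coef_sum (bigD1 i) //= coefZ coefXn eqxx mulr1 big1 ?addr0 //.
  by move=> j /negPf ji; rewrite coefZ coefXn eq_sym val_eqE ji mulr0.
rewrite linear_sum; apply/modp_eq0P; rewrite -[RHS]e.
rewrite (big_morph (fun p => p %% q) (id1 := 0) (op1 := +%R)) ?mod0p //; last exact: modpD.
by apply: eq_bigr => j _; rewrite linearZ /= comp_Xn_poly modpZl.
Qed.

Hypothesis charL : [pchar L] =i pred0.

Lemma exists_primitive p : exists r, r^`() = p.
Proof.
exists (\poly_(i < (size p).+1) (p`_i.-1 / i%:R)); apply/polyP => i.
rewrite coef_deriv coef_poly ltnS; case: ltnP => [_|le]; last first.
  by rewrite mul0rn nth_default.
by rewrite -[LHS]mulr_natr mulfVK // ((pcharf0P _).1 charL).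
Qed.

Lemma deriv_eq0 p : p^`() = 0 -> (size p <= 1)%N.
Proof.
move=> p'0; apply/leq_sizeP => -[//|j] _.
have /eqP := congr1 (fun r : {poly L} => r`_j) p'0.
by rewrite coef_deriv coef0 -mulr_natr mulf_eq0 ((pcharf0P _).1 charL) orbF => /eqP.
Qed.

Lemma irreducible_ndvdp_deriv q : irreducible_poly q -> ~~ (q %| q^`()).
Proof.
move=> qI; have q0 := irredp_neq0 qI; have q1 := qI.1.
have q'0 : q^`() != 0 by apply: contraTneq q1 => /deriv_eq0; rewrite leqNgt.
by apply: contraTN isT => /(dvdp_leq q'0); rewrite leqNgt lt_size_deriv.
Qed.

End Polynomials.

Definition derivation (A : nzRingType) (D : A -> A) :=
  {morph D : x y / x + y} /\ (forall x y, D (x * y) = D x * y + x * D y).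

(** * Derivations *)

Section DerivationTheory.
Variables (A : nzRingType) (D : A -> A) (der_D : derivation D).

Lemma der0 : D 0 = 0.
Proof. by apply: (addrI (D 0)); rewrite -der_D.1 !addr0. Qed.

Lemma der1 : D 1 = 0.
Proof.
by apply: (addrI (D 1)); rewrite addr0 -[RHS]/(D 1) -[in RHS](mulr1 1) der_D.2 mulr1 mul1r.
Qed.

Lemma derN x : D (- x) = - D x.
Proof. by apply/eqP; rewrite -subr_eq0 opprK -der_D.1 addNr der0. Qed.

Lemma derB x y : D (x - y) = D x - D y.
Proof. by rewrite der_D.1 derN. Qed.

Lemma der_sum (I : Type) (s : seq I) (P : pred I) (f : I -> A) :
  D (\sum_(i <- s | P i) f i) = \sum_(i <- s | P i) D (f i).
Proof. exact: (big_morph D der_D.1 der0). Qed.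

Lemma coef_map_der (p : {poly A}) i : (map_poly D p)`_i = D p`_i.
Proof. by rewrite coef_map_id0 ?der0. Qed.

Lemma map_poly_der : derivation (map_poly D).
Proof.
split=> p q; apply/polyP => i; first by rewrite !(coef_map_der, coefD) der_D.1.
rewrite coefD !(coef_map_der, coefM) der_sum -big_split /=; apply: eq_bigr => j _.
by rewrite der_D.2 !coef_map_der.
Qed.

Lemma map_derC c : map_poly D c%:P = (D c)%:P.
Proof. by apply/polyP => i; rewrite coef_map_der !coefC; case: eqP; rewrite ?der0. Qed.

Lemma map_derX : map_poly D 'X = 0.
Proof.
apply/polyP => i; rewrite coef_map_der coefX coef0.
by case: eqP => _; rewrite ?der0 ?der1.
Qed.

End DerivationTheory.

Lemma map_der_comp (A : comNzRingType) (D : A -> A) (M r : {poly A}) :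
  derivation D ->
  map_poly D (M \Po r) = (map_poly D M \Po r) + (M^`() \Po r) * map_poly D r.
Proof.
move=> dD; have dM := map_poly_der dD.
elim/poly_ind: M => [|M c IHM].
  by rewrite deriv0 (der0 dM) !comp_poly0 (der0 dM) mul0r addr0.
rewrite comp_poly_MXaddC dM.1 dM.2 dM.1 dM.2 map_derC // map_derX // mulr0 addr0.
rewrite comp_poly_MXaddC derivD derivC addr0 derivM derivX mulr1 IHM.
rewrite comp_polyD comp_polyM comp_polyX; ring.
Qed.

Lemma der_div (F : fieldType) (D : F -> F) x y : derivation D -> y != 0 ->
  D (x / y) = (D x * y - x * D y) / y ^+ 2.
Proof.
move=> dD y0; have : D x = D (x / y * y) by rewrite mulfVK.
rewrite dD.2 => e; have -> : D (x / y) = (D x - x / y * D y) / y.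
  by rewrite e addrK mulfK.
by field.
Qed.

Lemma der_logder (F : fieldType) (D1 D2 : F -> F) x :
  derivation D1 -> derivation D2 -> x != 0 -> D1 (D2 x) = D2 (D1 x) ->
  D1 (D2 x / x) = D2 (D1 x / x).
Proof. by move=> d1 d2 x0 c; rewrite !der_div // c; congr (_ / _); ring. Qed.

(** * Functions of one variable with exact derivatives *)

Section OneVariable.
(** In the application [L] is [K(x_0, ..., x_(i-1))], [F] is [L(x_i)], [ev] includes [L[x_i]] in
    [F], [d] is the derivative in [x_i], and each [delta] is the derivative in another variable,
    acting on coefficients through [dL]. The last two hypotheses say that [K] is the field of
    constants of [L]. *)
Variables (K : closedFieldType) (L F : fieldType) (I : Type).
Variables (kappa : {rmorphism K -> L}) (ev : {rmorphism {poly L} -> F}).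
Variables (dL : I -> L -> L) (delta : I -> F -> F) (d : F -> F).
Hypothesis charL : [pchar L] =i pred0.
Hypothesis ev_inj : injective ev.
Hypothesis ev_frac : forall h, exists p q : {poly L}, q != 0 /\ h = ev p / ev q.
Hypothesis der_d : derivation d.
Hypothesis der_delta : forall i, derivation (delta i).
Hypothesis der_dL : forall i, derivation (dL i).
Hypothesis d_ev : forall p, d (ev p) = ev p^`().
Hypothesis delta_ev : forall i p, delta i (ev p) = ev (map_poly (dL i) p).
Hypothesis d_delta : forall i x, d (delta i x) = delta i (d x).
Hypothesis dL_kappa : forall i c, dL i (kappa c) = 0.
Hypothesis dL_eq0 : forall x, (forall i, dL i x = 0) -> exists c, x = kappa c.

Local Notation kc c := (ev (kappa c)%:P).

Lemma ev_eq0 p : (ev p == 0) = (p == 0).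
Proof. by rewrite -(inj_eq ev_inj) rmorph0. Qed.

(** Differentiation turns a pole of order [m > 0] at [q] into one of order [m + 1], so a derivative
    never has a simple pole. *)
Lemma simple_pole_not_exact q E B b :
  irreducible_poly q -> ~~ (q %| E) -> d b = ev B / ev (q * E) -> q %| B.
Proof.
move=> qI qE; have q0 := irredp_neq0 qI.
have E0 : E != 0 by apply: contraNneq qE => ->; rewrite dvdp0.
have [P [Q [Q0 ->]]] := ev_frac b.
have [m [Q1 [-> qQ1]]] := irreducible_valuation qI Q0 => {Q Q0 b}.
have Q10 : Q1 != 0 by apply: contraNneq qQ1 => ->; rewrite dvdp0.
have qX k : q ^+ k != 0 by rewrite expf_neq0.
have eqP_of k P1 : d (ev P1 / ev (q ^+ k * Q1)) = ev B / ev (q * E) ->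
    (P1^`() * (q ^+ k * Q1) - P1 * (q ^+ k * Q1)^`()) * (q * E)
      = B * (q ^+ k * Q1) ^+ 2.
  rewrite der_div ?ev_eq0 ?mulf_neq0 // !d_ev => /eqP.
  rewrite eqr_div ?expf_neq0 ?ev_eq0 ?mulf_neq0 // -!rmorphM -rmorphB -rmorphXn -!rmorphM.
  by move=> /eqP/ev_inj.
(* Induction on the exponent of [q] in the denominator of [b]: a factor [q] common to numerator and
   denominator is cancelled, and a genuine pole is contradictory. *)
elim: m P => [|m IHm] P.
  move/eqP_of; rewrite expr0 mul1r mulrCA => e.
  have : q %| B * Q1 ^+ 2 by rewrite -e dvdp_mulr.
  by case/(irreducible_dvdpM qI)/orP => // /(irreducible_dvdpX qI); rewrite (negPf qQ1).
have [/dvdpP[P1 ->]|qP] := boolP (q %| P).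
  set h := ev B / _; rewrite exprS [P1 * q]mulrC -mulrA !(rmorphM _ q).
  rewrite -mulf_div divff ?ev_eq0 // mul1r.
  exact: IHm.
move/eqP_of; rewrite derivM deriv_exp /= => e.
have {}e : (q * (P^`() * Q1 - P * Q1^`()) - m.+1%:R * (P * q^`() * Q1)) * E
    = B * q ^+ m.+1 * Q1 ^+ 2.
  apply: (mulfI (qX m.+1)); rewrite -mulr_natl in e.
  have -> : q ^+ m.+1 * (B * q ^+ m.+1 * Q1 ^+ 2) = B * (q ^+ m.+1 * Q1) ^+ 2 by ring.
  by rewrite -e exprS; ring.
(* Modulo [q] only [-(m+1) P q' Q1 E] survives, and [q] divides none of its factors. *)
have : q %| (q * (P^`() * Q1 - P * Q1^`()) - m.+1%:R * (P * q^`() * Q1)) * E.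
  by rewrite e exprS -!mulrA mulrCA dvdp_mulr.
case/(irreducible_dvdpM qI)/orP => [|/idPn[]] //.
rewrite dvdp_subr; last exact: dvdp_mulr.
rewrite -(rmorph_nat (@polyC L)) mul_polyC dvdpZr ?((pcharf0P _).1 charL) //.
case/(irreducible_dvdpM qI)/orP => [|/idPn[]] //.
case/(irreducible_dvdpM qI)/orP => [/idPn[]|/idPn[]] //.
exact: irreducible_ndvdp_deriv.
Qed.

(** The identity for [map_poly (dL i) q] makes [dL i - w d/dx] preserve the ideal of [q]; the
    divisibility says that it kills the class of [t]. The minimal polynomial [M] of that class then
    has coefficients in [K], which is algebraically closed, so the class is a root of [M] in [K]. *)
Lemma constant_mod q t : irreducible_poly q ->
    (forall i, exists w z, map_poly (dL i) q = w * q^`() + z * q /\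
       q %| map_poly (dL i) t - w * t^`()) ->
  exists c, q %| t - (kappa c)%:P.
Proof.
move=> qI ht; have q0 := irredp_neq0 qI.
pose ann n := `[< exists M : {poly L}, [/\ M != 0, q %| M \Po t & size M = n] >].
have ex_ann : exists n, ann n.
  have [M M0 qM] := exists_annihilator_mod t q0.
  by exists (size M); apply/asboolP; exists M.
have [n /asboolP[M [M0 qM sM]] minM] := ex_minnP ex_ann => {ex_ann}.
have {minM} minM p : q %| p \Po t -> (size p < size M)%N -> p = 0.
  move=> qp; apply: contraTeq => p0; rewrite -leqNgt sM; apply: minM.
  by apply/asboolP; exists p.
(* The leading coefficient 1 is killed by every [dL i], so applying [dL i] to the coefficients of a
   monic [M] lowers its degree. *)
wlog monM : M M0 qM sM minM / M \is monic.
  have c0 : (lead_coef M)^-1 != 0 by rewrite invr_eq0 lead_coef_eq0.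
  move=> W; apply: (W ((lead_coef M)^-1 *: M)); rewrite ?size_scale //.
  - by rewrite scaler_eq0 negb_or c0.
  - by rewrite comp_polyZ dvdpZr.
  - by rewrite monicE lead_coefZ mulVf // lead_coef_eq0.
have sM1 : (1 < size M)%N.
  rewrite ltnNge; apply/negP => /size1_polyC Me; have := qM.
  have c0 : (M`_0)%:P != 0 by rewrite -Me.
  rewrite Me comp_polyC => /(dvdp_leq c0) /leq_trans /(_ (size_polyC_leq1 _)).
  by rewrite leqNgt qI.1.
(* [dL i - w d/dx] is a derivation of L[x]/q killing t, so it sends [M(t) = 0]
   to [(dL i M)(t) = 0], where [dL i M] has smaller degree. *)
have dM i : map_poly (dL i) M = 0.
  have dP := map_poly_der (der_dL i); have [w [z [dq qt]]] := ht i.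
  apply: minM.
    have qd u : q %| u -> q %| map_poly (dL i) u - w * u^`().
      case/dvdpP=> v ->; rewrite dP.2 dq derivM.
      have -> : map_poly (dL i) v * q + v * (w * q^`() + z * q)
          - w * (v^`() * q + v * q^`())
        = q * (map_poly (dL i) v + v * z - w * v^`()) by ring.
      exact: dvdp_mulr.
    have := qd _ qM; rewrite map_der_comp // deriv_comp.
    have -> : (map_poly (dL i) M \Po t) + (M^`() \Po t) * map_poly (dL i) t
        - w * ((M^`() \Po t) * t^`())
      = (map_poly (dL i) M \Po t) + (M^`() \Po t) * (map_poly (dL i) t - w * t^`()).
      by ring.
    by rewrite dvdp_addl // dvdp_mull.
  rewrite -(prednK (ltnW sM1)); apply/leq_sizeP => j.
  rewrite leq_eqVlt => /orP[/eqP<-|lt_j]; rewrite coef_map_der //.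
    by have /monicP := monM; rewrite lead_coefE => ->; apply: der1.
  by rewrite nth_default ?der0 // -(prednK (ltnW sM1)).
have /choice[k kE] : forall j, exists c, M`_j = kappa c.
  by move=> j; apply: dL_eq0 => i; rewrite -coef_map_der // dM coef0.
pose M1 := \poly_(j < size M) k j.
have M1E : M = map_poly kappa M1.
  apply/polyP => j; rewrite coef_map coef_poly /=; case: ltnP => [_|le]; first exact: kE.
  by rewrite rmorph0 nth_default.
(* A root [c] of [M1] splits off a linear factor; if [q] divided the cofactor at [t], minimality of
   [M] would make that cofactor zero. *)
have [|c /factor_theorem[M2 M2E]] := closed_rootP M1 _.
  by rewrite neq_ltn; move: sM1; rewrite M1E size_map_poly => ->; rewrite orbT.
exists c; move: qM; rewrite M1E M2E rmorphM comp_polyM /=.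
rewrite rmorphB /= map_polyX map_polyC /= comp_polyB comp_polyX comp_polyC.
case/(irreducible_dvdpM qI)/orP => // /minM h.
have M20 : map_poly kappa M2 != 0.
  by apply: contraNneq M0 => e; rewrite M1E M2E rmorphM /= e mul0r.
case/eqP: (M20); apply: h; rewrite M1E M2E size_map_poly size_map_poly.
rewrite size_Mmonic ?monicXsubC ?size_XsubC ?addn2 //.
by apply: contraNneq M20 => ->; rewrite rmorph0.
Qed.
(** Write [D] for [dL i] on coefficients, with [D q = w q' + z q]. As
    [delta i (q'/q) = d (D q / q)], subtracting [d (t D q / q)] leaves an exact function with at
    most a simple pole at [q], whose numerator modulo [q] is [(D t - w t') q' E^2]. Having no simple
    pole, it forces [q] to divide [D t - w t']. *)
Lemma simple_pole_residue q E s t :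
    irreducible_poly q -> ~~ (q %| E) ->
    (forall i, exists b,
      delta i (ev s / ev E + ev t * (ev q^`() / ev q)) = d b) ->
  exists c, q %| t - (kappa c)%:P.
Proof.
move=> qI qE hb; have q0 := irredp_neq0 qI.
have E0 : E != 0 by apply: contraNneq qE => ->; rewrite dvdp0.
have qq' := irreducible_ndvdp_deriv charL qI.
apply: constant_mod => // i; set D := map_poly (dL i).
have [z [w Dq]] := bezout_irreducible (D q) qI qq'.
exists w, z; split; first by rewrite Dq addrC.
have [b hbE] := hb i.
pose B := (D t - w * t^`()) * (q^`() * E ^+ 2)
  + q * (D s * E - s * D E - z * t^`() * E ^+ 2).
have qE2 : ~~ (q %| E ^+ 2) by apply: contraNN qE; apply: irreducible_dvdpX.
have dlogE : delta i (ev q^`() / ev q) = d (ev (D q) / ev q).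
  by rewrite -d_ev (@der_logder _ (delta i) d) ?ev_eq0 // delta_ev.
have : d (b - ev t * (ev (D q) / ev q)) = ev B / ev (q * E ^+ 2).
  rewrite derB // -hbE (der_delta i).1 ((der_delta i).2 (ev t)) der_d.2 dlogE d_ev.
  rewrite der_div ?ev_eq0 // !delta_ev -/D.
  rewrite Dq /B !(rmorphD, rmorphB, rmorphM, rmorphXn) /=; field.
  by rewrite !ev_eq0 ?q0 ?E0.
move/(simple_pole_not_exact qI qE2); rewrite dvdp_addl; last exact: dvdp_mulr.
case/(irreducible_dvdpM qI)/orP => // /(irreducible_dvdpM qI).
by rewrite (negPf qq') (negPf qE2).
Qed.

Definition log_exact (h : F) := exists (r : F) (s : seq (K * F)),
  all (fun z => z.2 != 0) s /\
  h = d r + \sum_(z <- s) kc z.1 * (d z.2 / z.2).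

Lemma log_exact_exact r : log_exact (d r).
Proof. by exists r, [::]; rewrite big_nil addr0. Qed.

Lemma log_exactD h1 h2 : log_exact h1 -> log_exact h2 -> log_exact (h1 + h2).
Proof.
move=> [r1 [s1 [s10 ->]]] [r2 [s2 [s20 ->]]]; exists (r1 + r2), (s1 ++ s2).
by rewrite all_cat s10 s20 der_d.1 big_cat addrACA.
Qed.

Lemma log_exact_dlog c f : f != 0 -> log_exact (kc c * (d f / f)).
Proof.
by move=> f0; exists 0, [:: (c, f)]; rewrite /= f0 big_seq1 der0 // add0r.
Qed.

(** An antiderivative of [delta i h] arises by replacing [d] by [delta i] in the expression of [h].
    This lets the exactness hypothesis pass to what remains after a part of a function has been
    integrated. *)
Lemma log_exact_delta h : log_exact h -> forall i, exists b, delta i h = d b.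
Proof.
move=> [r [s [s0 ->]]] i.
exists (delta i r + \sum_(z <- s) kc z.1 * (delta i z.2 / z.2)).
rewrite der_d.1 (der_delta i).1 d_delta (der_sum der_d) (der_sum (der_delta i)).
congr (_ + _).
rewrite !big_seq; apply: eq_bigr => z /(allP s0) z0.
rewrite der_d.2 (der_delta i).2 delta_ev d_ev derivC map_derC // dL_kappa.
by rewrite polyC0 !rmorph0 !mul0r !add0r der_logder.
Qed.

(** Strong induction on the degree of the denominator: each step splits off an integrable part and
    removes one irreducible factor [q]. *)
Lemma log_exact_of_delta_exact h :
  (forall i, exists b, delta i h = d b) -> log_exact h.
Proof.
have [N [D [D0 ->]]] := ev_frac h.
have [n] := ubnP (size D); elim: n => // n IHn in N D D0 * => leDn hb.
have reduce N1 D1 h1 : ev N / ev D = ev N1 / ev D1 + h1 -> log_exact h1 ->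
    D1 != 0 -> (size D1 < size D)%N -> log_exact (ev N / ev D).
  move=> e h1le D10 ltD; rewrite e; apply: log_exactD => //; apply: IHn => //.
    by rewrite ltnS in leDn; apply: leq_trans leDn.
  move=> i; have [b hbE] := hb i; have [b1 hb1] := log_exact_delta h1le i.
  exists (b - b1); rewrite derB // -hbE -hb1 e (der_delta i).1; ring.
(* A constant denominator leaves a polynomial, which has a primitive in characteristic zero. *)
have [D1|D1] := leqP (size D) 1.
  have [r rE] := exists_primitive charL ((D`_0)^-1 *: N).
  have D00 : D`_0 != 0 by apply: contraNneq D0 => e; rewrite (size1_polyC D1) e.
  suff -> : ev N / ev D = d (ev r) by apply: log_exact_exact.
  apply: (canLR (mulfK _)); rewrite ?ev_eq0 // d_ev rE -rmorphM; congr (ev _).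
  by rewrite {2}(size1_polyC D1) mulrC mul_polyC scalerA mulfV // scale1r.
have [q qI qD] := exists_irreducible_dvdp D1; have q0 := irredp_neq0 qI.
have qq' := irreducible_ndvdp_deriv charL qI.
have [m [E [DE qE]]] := irreducible_valuation qI D0.
have E0 : E != 0 by apply: contraNneq qE => ->; rewrite dvdp0.
have ltq (p : {poly L}) : p != 0 -> (size p < size (q * p)%R)%N.
  move=> p0; rewrite size_mul //; have := qI.1.
  by case: (size q) => [|[|k]] // _; rewrite !addSn /= ltnS leq_addl.
have qq'E : ~~ (q %| q^`() * E).
  by apply/negP => /(irreducible_dvdpM qI); rewrite (negPf qq') (negPf qE).
case: m DE => [|[|m]] DE; first by move: qE; rewrite DE mul1r in qD; rewrite qD.
  (* Partial fractions with [q' E] in place of [E], so that the polar part at [q] is already [t]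
     times the logarithmic derivative of [q]. *)
  have [s [t NE]] := bezout_irreducible N qI qq'E.
  have e : ev N / ev D = ev s / ev E + ev t * (ev q^`() / ev q).
    rewrite DE NE expr1 !(rmorphD, rmorphM) /=; field.
    by rewrite !ev_eq0 ?q0 ?E0.
  have [c /dvdpP[u tE]] : exists c, q %| t - (kappa c)%:P.
    apply: (@simple_pole_residue q E s t qI qE) => i.
    by have [b] := hb i; rewrite e => be; exists b.
  (* With [t = u q + c], the polar part is [u q' + c q'/q]; its first term joins the fraction over
     [E]. *)
  apply: (reduce (s + u * q^`() * E) E (kc c * (d (ev q) / ev q))) => //.
  - rewrite e d_ev; have -> : t = u * q + (kappa c)%:P by rewrite -tE subrK.
    rewrite !(rmorphD, rmorphM) /=; field.
    by rewrite !ev_eq0 ?q0 ?E0.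
  - by apply: log_exact_dlog; rewrite ev_eq0.
  - by rewrite DE expr1 ltq.
(* Hermite reduction: integrating by parts lowers the order of the pole at q. *)
have c0 : m.+1%:R != 0 :> L by rewrite ((pcharf0P _).1 charL).
(* The factor comes from [d (t / q^(m+1)) = t' / q^(m+1) - (m+1) t q' / q^(m+2)]. *)
pose cP : {poly L} := - m.+1%:R.
have qcE : ~~ (q %| cP * (q^`() * E)).
  by rewrite /cP -(rmorph_nat (@polyC L)) -polyCN mul_polyC dvdpZr // oppr_eq0.
have [s [t NE]] := bezout_irreducible N qI qcE.
apply: (reduce (s - t^`() * E) (q ^+ m.+1 * E) (d (ev t / ev (q ^+ m.+1)))).
- rewrite der_div ?ev_eq0 ?expf_neq0 // !d_ev deriv_exp /= -mulr_natl.
  rewrite DE NE /cP !exprS !(rmorphD, rmorphB, rmorphM, rmorphXn, rmorphN, rmorph_nat) /=.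
  by field; rewrite !ev_eq0 q0 E0 expf_neq0 ?ev_eq0.
- exact: log_exact_exact.
- by rewrite mulf_neq0 ?expf_neq0.
- by rewrite DE [q ^+ m.+2]exprS -mulrA ltq // mulf_neq0 ?expf_neq0.
Qed.

End OneVariable.

(** * Partial derivatives of rational functions *)

Lemma quotient_ruleD (F : fieldType) (a a' b b' c c' e e' : F) :
  b != 0 -> e != 0 ->
  ((a' * e + a * e' + (c' * b + c * b')) * (b * e)
    - (a * e + c * b) * (b' * e + b * e')) / (b * e) ^+ 2
  = (a' * b - a * b') / b ^+ 2 + (c' * e - c * e') / e ^+ 2.
Proof. by move=> b0 e0; field; rewrite e0 b0. Qed.

Lemma quotient_ruleM (F : fieldType) (a a' b b' c c' e e' : F) :
  b != 0 -> e != 0 ->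
  ((a' * c + a * c') * (b * e) - a * c * (b' * e + b * e')) / (b * e) ^+ 2
  = (a' * b - a * b') / b ^+ 2 * (c / e) + a / b * ((c' * e - c * e') / e ^+ 2).
Proof. by move=> b0 e0; field; rewrite e0 b0. Qed.

Lemma quotient_rule_log (F : fieldType) (a a' b b' : F) : a != 0 -> b != 0 ->
  (a' * b - a * b') / b ^+ 2 / (a / b) = a' / a - b' / b.
Proof. by move=> a0 b0; field; rewrite a0 b0. Qed.

Lemma cancel_cross_terms (A : idomainType) (u v a b r s t w: A) : r != 0 ->
  u * r + a * s + (b * t + w) = v * r + b * t + (a * s + w) -> u = v.
Proof.
move=> r0 e; apply: (mulIf r0); apply: (addIr (a * s + b * t + w)).
have -> : u * r + (a * s + b * t + w) = u * r + a * s + (b * t + w) by ring.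
by rewrite e; ring.
Qed.

Section RationalFunctions.
Variables (K : fieldType) (n : nat).
Implicit Types (p q : {mpoly K[n]}) (x y : ratfun K n) (i j : 'I_n).

Lemma partial_tofrac i p : partial i p%:F = (mderiv i p)%:F.
Proof.
rewrite -[p%:F]divr1 -tofrac1 partialE ?oner_neq0 //.
by rewrite -mpolyC1 mderivC mulr0 subr0 mpolyC1 mulr1 expr1n tofrac1 divr1.
Qed.

Lemma ratfunP x : exists p q : {mpoly K[n]}, q != 0 /\ x = p%:F / q%:F.
Proof.
by exists (\n_(repr x)), (\d_(repr x)); split; [apply: denom_ratioP | apply: fracE].
Qed.

Lemma partial_derivation i : derivation (@partial K n i).
Proof.
split=> x y; have [p [q [q0 ->]]] := ratfunP x; have [r [s [s0 ->]]] := ratfunP y.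
  have -> : p%:F / q%:F + r%:F / s%:F = (p * s + r * q)%:F / (q * s)%:F.
    by rewrite tofracD !tofracM addf_div ?tofrac_eq0.
  rewrite !partialE ?mulf_neq0 //.
  rewrite !rmorphXn mderivD !mderivM !rmorphB !rmorphM !rmorphD !rmorphM /=.
  by apply: quotient_ruleD; rewrite tofrac_eq0.
have -> : p%:F / q%:F * (r%:F / s%:F) = (p * r)%:F / (q * s)%:F.
  by rewrite !tofracM mulf_div.
rewrite !partialE ?mulf_neq0 //.
rewrite !rmorphXn !mderivM !rmorphB !rmorphM !rmorphD !rmorphM /=.
by apply: quotient_ruleM; rewrite tofrac_eq0.
Qed.

(** Both orders agree on the polynomial [x * q]. Expanded by the Leibniz rule, the two sides share
    all terms except [q] times the mixed derivatives of [x]. *)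
Lemma partial_comm i j x : partial i (partial j x) = partial j (partial i x).
Proof.
have [dpi dpj] := (partial_derivation i, partial_derivation j).
have [p [q [q0 xE]]] := ratfunP x; rewrite -tofrac_eq0 in q0.
have : partial i (partial j (x * q%:F)) = partial j (partial i (x * q%:F)).
  by rewrite xE mulfVK // !partial_tofrac mderiv_comm.
rewrite (dpj.2 x) (dpi.2 x) dpi.1 dpj.1 (dpi.2 (partial j x)) (dpi.2 x).
rewrite (dpj.2 (partial i x)) (dpj.2 x) !partial_tofrac (mderiv_comm i j).
exact: cancel_cross_terms q0.
Qed.

Lemma msize_mderiv_lt i p : mderiv i p != 0 -> (msize (mderiv i p) < msize p)%N.
Proof.
move=> p'0; rewrite -(mlead_deg p'0); have := mlead_supp p'0.
rewrite mcoeff_msupp mcoeff_deriv => m0.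
have : p@_(mlead (mderiv i p) + U_(i)) != 0 by apply: contraNneq m0 => ->; rewrite mul0rn.
by rewrite -mcoeff_msupp => /msize_mdeg_lt; rewrite mdegD mdeg1 addn1.
Qed.

Lemma mderiv_eq0_const p : [pchar K] =i pred0 ->
  (forall i, mderiv i p = 0) -> p = (p@_0)%:MP.
Proof.
move=> charK dp; apply/mpolyP => m; rewrite mcoeffC.
have [->|m0] := eqVneq m 0%MM; first by rewrite mulr1.
have [i mi] : exists i, m i != 0%N.
  by apply: contra_notP (elimN eqP m0) => h; apply/mnmP => i; rewrite mnm0E;
     apply: contra_notP h => /eqP mi; exists i.
have mE : m = (m - U_(i) + U_(i))%MM.
  by rewrite submK //; apply/mnm_lepP => j; rewrite mnm1E; case: eqP => // <-; rewrite lt0n.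
have /eqP := congr1 (fun q => q@_(m - U_(i))) (dp i).
rewrite mcoeff_deriv -mE mcoeff0 -[_ *+ _]mulr_natr mulf_eq0 ((pcharf0P _).1 charK) orbF.
by move/eqP=> ->; rewrite mulr0.
Qed.

(* From [partial i (p / q) = 0] one gets [p / q = mderiv i p / mderiv i q], so a
   denominator of least degree has [mderiv i q = 0]. *)
Lemma mderiv_minimal_fraction x : exists p q : {mpoly K[n]}, [/\ q != 0, x = p%:F / q%:F
  & forall i, partial i x = 0 -> mderiv i p = 0 /\ mderiv i q = 0].
Proof.
pose repr_size m :=
  `[< exists p q : {mpoly K[n]}, [/\ q != 0, x = p%:F / q%:F & msize q = m] >].
have ex_repr : exists m, repr_size m.
  have [p [q [q0 xE]]] := ratfunP x.
  by exists (msize q); apply/asboolP; exists p, q.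
have [m /asboolP[p [q [q0 xE <-]]] minq] := ex_minnP ex_repr => {m}.
exists p, q; split=> // i; rewrite xE partialE // => /eqP.
rewrite mulf_eq0 invr_eq0 !tofrac_eq0 expf_eq0 (negPf q0) orbF subr_eq0 => /eqP e.
have [q'0|q'0] := eqVneq (mderiv i q) 0.
  move: e; rewrite q'0 mulr0 => /eqP.
  by rewrite mulf_eq0 (negPf q0) orbF => /eqP ->.
have := msize_mderiv_lt q'0; rewrite ltnNge minq //.
apply/asboolP; exists (mderiv i p), (mderiv i q); split=> //; rewrite xE.
by apply/eqP; rewrite eqr_div ?tofrac_eq0 // -!tofracM e mulrC.
Qed.

End RationalFunctions.

(** * Elimination of one variable *)

(* [F] stands for [ratfun K n], kept abstract because unification would unfold
   the construction of the fraction field. *)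
Section DifferentialField.
Variables (K : closedFieldType) (n : nat) (F : fieldType).
Variables (iota : {rmorphism {mpoly K[n]} -> F}) (d : 'I_n -> F -> F).
Hypothesis charK : [pchar K] =i pred0.
Hypothesis iota_inj : injective iota.
Hypothesis der_d : forall i, derivation (d i).
Hypothesis d_comm : forall i j x, d i (d j x) = d j (d i x).
Hypothesis d_iota : forall i p, d i (iota p) = iota (mderiv i p).
Hypothesis minimal_fraction : forall x, exists p q : {mpoly K[n]},
  [/\ q != 0, x = iota p / iota q
     & forall i, d i x = 0 -> mderiv i p = 0 /\ mderiv i q = 0].
Implicit Types (a : 'I_n -> F) (i j : 'I_n).

(* The subfield K(x_0, ..., x_(k-1)), cut out as the joint kernel of the
   remaining d derivatives (characteristic 0). *)
Definition first_vars (k : nat) : {pred F} :=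
  [pred x | [forall j : 'I_n, (k <= j)%N ==> (d j x == 0)]].

Lemma first_varsP k x :
  reflect (forall j : 'I_n, (k <= j)%N -> d j x = 0) (x \in first_vars k).
Proof.
apply: (iffP forallP) => h j; first by move=> kj; apply/eqP/(implyP (h j)).
by apply/implyP => kj; apply/eqP/h.
Qed.

Lemma first_vars_divring k : divring_closed (first_vars k).
Proof.
split=> [|x y|x y]; try move=> /first_varsP hx /first_varsP hy.
all: apply/first_varsP => j kj; have dj := der_d j.
- exact: der1.
- by rewrite derB // hx // hy // subr0.
- have [->|y0] := eqVneq y 0; first by rewrite invr0 mulr0 der0.
  by rewrite der_div // hx // hy // mulr0 mul0r subr0 mul0r.
Qed.

HB.instance Definition _ k :=
  GRing.isDivringClosed.Build (F) (first_vars k) (first_vars_divring k).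

(** As a type, the subfield can serve as the field [L], and its successor as [F], in the
    one-variable results. *)
Record subratfun (k : nat) :=
  SubRatfun { ratfun_of :> F; ratfun_ofP : ratfun_of \in first_vars k }.

HB.instance Definition _ k := [isSub for @ratfun_of k].
HB.instance Definition _ k := [Choice of subratfun k by <:].
HB.instance Definition _ k := [SubChoice_isSubIntegralDomain of subratfun k by <:].
HB.instance Definition _ k := [SubIntegralDomain_isSubField of subratfun k by <:].

Lemma partial_first_vars i k x : x \in first_vars k -> d i x \in first_vars k.
Proof.
move=> /first_varsP hx; apply/first_varsP => j kj.
by rewrite d_comm hx // (der0 (der_d _)).
Qed.

Definition sub_partial k i (x : subratfun k) : subratfun k :=
  SubRatfun (partial_first_vars i (ratfun_ofP x)).

Lemma sub_partial_derivation k i : derivation (@sub_partial k i).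
Proof. by split=> x y; apply: val_inj; apply: (der_d i).1 || apply: (der_d i).2. Qed.

Lemma first_varsS k x : x \in first_vars k -> x \in first_vars k.+1.
Proof. by move=> /first_varsP hx; apply/first_varsP => j /ltnW/hx. Qed.

Definition widen_subratfun k (x : subratfun k) : subratfun k.+1 :=
  SubRatfun (first_varsS (ratfun_ofP x)).

Lemma widen_is_zmod_morphism k : zmod_morphism (@widen_subratfun k).
Proof. by move=> x y; apply: val_inj. Qed.
Lemma widen_is_monoid_morphism k : monoid_morphism (@widen_subratfun k).
Proof. by split=> [|x y]; apply: val_inj. Qed.
HB.instance Definition _ k := GRing.isZmodMorphism.Build
  (subratfun k) (subratfun k.+1) (@widen_subratfun k) (@widen_is_zmod_morphism k).
HB.instance Definition _ k := GRing.isMonoidMorphism.Build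
  (subratfun k) (subratfun k.+1) (@widen_subratfun k) (@widen_is_monoid_morphism k).

Lemma const_first_vars k (c : K) : iota c%:MP \in first_vars k.
Proof. by apply/first_varsP => j _; rewrite d_iota mderivC rmorph0. Qed.

Definition const_subratfun k (c : K) : subratfun k := SubRatfun (const_first_vars k c).

Lemma const_is_zmod_morphism k : zmod_morphism (@const_subratfun k).
Proof. by move=> x y; apply: val_inj => /=; rewrite mpolyCB rmorphB. Qed.
Lemma const_is_monoid_morphism k : monoid_morphism (@const_subratfun k).
Proof.
split=> [|x y]; apply: val_inj => /=; first by rewrite mpolyC1 rmorph1.
by rewrite mpolyCM rmorphM.
Qed.
HB.instance Definition _ k := GRing.isZmodMorphism.Build
  K (subratfun k) (@const_subratfun k) (@const_is_zmod_morphism k).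
HB.instance Definition _ k := GRing.isMonoidMorphism.Build
  K (subratfun k) (@const_subratfun k) (@const_is_monoid_morphism k).

Lemma pchar_subratfun k : [pchar subratfun k] =i pred0.
Proof. by move=> p; rewrite (fmorph_pchar (@const_subratfun k)). Qed.

(** * Adjoining the next variable *)

Section NextVariable.
Variable i : 'I_n.

Lemma var_first_vars : iota 'X_i \in first_vars i.+1.
Proof.
apply/first_varsP => j ij; rewrite d_iota mderivX mnm1E.
by rewrite (_ : i == j = false) ?scale0r ?rmorph0 //; apply/eqP => e; rewrite e ltnn in ij.
Qed.

Definition var_subratfun : subratfun i.+1 := SubRatfun var_first_vars.

(** This evaluation at [x_i] plays the role of [ev]. *)
Definition subst_var : {poly subratfun i} -> subratfun i.+1 :=
  horner_morph (fun x => mulrC var_subratfun (widen_subratfun x)).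

HB.instance Definition _ := GRing.RMorphism.on subst_var.

Lemma subst_varMXaddC p c :
  subst_var (p * 'X + c%:P) = subst_var p * var_subratfun + widen_subratfun c.
Proof. by rewrite rmorphD rmorphM /= /subst_var horner_morphX horner_morphC. Qed.

Lemma sub_partial_var j : sub_partial j var_subratfun = (i == j)%:R.
Proof.
apply: val_inj; rewrite /= d_iota mderivX mnm1E.
case: eqP => [<-|_]; last by rewrite scale0r rmorph0.
by rewrite scale1r -[X in (X - _)%MM]add0m addmK mpolyX0 rmorph1.
Qed.

Lemma sub_partial_widen (c : subratfun i) : sub_partial i (widen_subratfun c) = 0.
Proof. by apply: val_inj; apply: (first_varsP _ _ (ratfun_ofP c)). Qed.

Lemma sub_partial_subst p : sub_partial i (subst_var p) = subst_var p^`().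
Proof.
have dP := sub_partial_derivation i.+1 i.
elim/poly_ind: p => [|p c IHp]; first by rewrite deriv0 rmorph0 der0.
rewrite subst_varMXaddC derivD derivM derivX derivC mulr1 addr0.
rewrite dP.1 dP.2 IHp sub_partial_var eqxx mulr1 sub_partial_widen addr0.
by rewrite rmorphD rmorphM /= /subst_var horner_morphX.
Qed.

Lemma sub_partial_subst_neq j p : j != i ->
  sub_partial j (subst_var p) = subst_var (map_poly (@sub_partial i j) p).
Proof.
move=> ji; have dP := sub_partial_derivation i.+1 j.
have dQ := sub_partial_derivation i j; have dM := map_poly_der dQ.
elim/poly_ind: p => [|p c IHp]; first by rewrite (der0 dM) rmorph0 der0.
rewrite subst_varMXaddC dM.1 dM.2 map_derC // map_derX // mulr0 addr0 subst_varMXaddC.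
rewrite dP.1 dP.2 IHp sub_partial_var eq_sym (negPf ji) mulr0 addr0.
by congr (_ + _); apply: val_inj.
Qed.

(** Differentiating a relation [p(x_i) = 0] gives a relation for [p'], of smaller degree, so
    [p' = 0] by induction; then [p] is a constant, and it vanishes because field morphisms are
    injective. *)
Lemma subst_var_inj : injective subst_var.
Proof.
suff eq0 m (p : {poly subratfun i}) : (size p < m)%N -> subst_var p = 0 -> p = 0.
  by apply: raddf_inj => p; apply: eq0 (ltnSn _).
elim: m p => // m IHm p ltm p0; have [//|pn0] := eqVneq p 0.
have p'0 : p^`() = 0.
  apply: IHm; first exact: leq_trans (lt_size_deriv pn0) ltm.
  by rewrite -sub_partial_subst p0 der0 //; apply: sub_partial_derivation.
have pC := size1_polyC (deriv_eq0 (pchar_subratfun i) p'0).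
move: p0; rewrite pC /subst_var horner_morphC => /eqP.
by rewrite fmorph_eq0 => /eqP ->; rewrite polyC0.
Qed.

(** Induction on the degree: [mderiv i P] is a polynomial in [x_i] over the smaller field, and a
    primitive of it there differs from [P] only by an element of that field. *)
Lemma mpoly_subst_var P : (forall j : 'I_n, (i < j)%N -> mderiv j P = 0) ->
  exists p, iota P = subst_var p :> F.
Proof.
have [m] := ubnP (msize P); elim: m P => // m IHm P ltm dP.
have [P'0|P'0] := eqVneq (mderiv i P) 0.
  have Pi : iota P \in first_vars i.
    apply/first_varsP => j; rewrite d_iota leq_eqVlt.
    by case/orP => [/eqP/val_inj<-|/dP->]; rewrite ?P'0 rmorph0.
  by exists (SubRatfun Pi)%:P; rewrite /subst_var horner_morphC.
have [||p' p'E] := IHm (mderiv i P).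
- by rewrite ltnS in ltm; apply: leq_trans ltm; apply: msize_mderiv_lt.
- by move=> j ij; rewrite mderiv_comm dP // mderiv0.
have [r rE] := exists_primitive (pchar_subratfun i) p'.
have yi : iota P - ratfun_of (subst_var r) \in first_vars i.
  apply/first_varsP => j; rewrite leq_eqVlt derB; last exact: der_d.
  rewrite d_iota => /orP[/eqP/val_inj<-|ij]; last first.
    by rewrite dP // rmorph0 sub0r (first_varsP _ _ (ratfun_ofP (subst_var r))) ?oppr0.
  by rewrite p'E -rE -sub_partial_subst /= subrr.
exists (r + (SubRatfun yi)%:P); rewrite rmorphD /= /subst_var horner_morphC /=.
by rewrite addrC subrK.
Qed.

(** The minimal fraction involves none of the variables after [x_i], so its numerator and
    denominator are polynomials in [x_i] over the smaller field. *)
Lemma subst_var_frac h :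
  exists p q : {poly subratfun i}, q != 0 /\ h = subst_var p / subst_var q.
Proof.
have [P [Q [Q0 hE dPQ]]] := minimal_fraction (ratfun_of h).
have d0 j : (i < j)%N -> mderiv j P = 0 /\ mderiv j Q = 0.
  by move=> ij; apply: dPQ; apply: (first_varsP _ _ (ratfun_ofP h)).
have [p pE] := mpoly_subst_var (fun j ij => (d0 j ij).1).
have [q qE] := mpoly_subst_var (fun j ij => (d0 j ij).2).
exists p, q; split; last by apply: val_inj; rewrite /= -pE -qE.
apply: contraNneq Q0 => q0; rewrite -(inj_eq iota_inj) rmorph0 qE q0.
by rewrite rmorph0.
Qed.

(** The derivative in [x_i] vanishes on this subfield anyway, so every derivative of [x] is zero and
    its minimal fraction has constant numerator and denominator. *)
Lemma sub_partial_eq0 (x : subratfun i) :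
  (forall j, j != i -> sub_partial j x = 0) -> exists c, x = const_subratfun i c.
Proof.
move=> dx; have dx0 j : d j x = 0.
  have [->|/dx/(congr1 (@ratfun_of i))//] := eqVneq j i.
  exact: (first_varsP _ _ (ratfun_ofP x)).
have [P [Q [Q0 xE dPQ]]] := minimal_fraction (ratfun_of x).
have PE := mderiv_eq0_const charK (fun j => (dPQ j (dx0 j)).1).
have QE := mderiv_eq0_const charK (fun j => (dPQ j (dx0 j)).2).
exists (P@_0 / Q@_0); rewrite fmorph_div; apply: val_inj => /=.
by rewrite xE {1}PE {1}QE.
Qed.

End NextVariable.

Lemma integrate_last_variable i (h : F) (b : 'I_n -> F) :
    h \in first_vars i.+1 -> (forall j, b j \in first_vars i.+1) ->
    (forall j, d j h = d i (b j)) ->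
  exists (r : F) (s : seq (K * F)),
    [/\ r \in first_vars i.+1,
        all (fun z => (z.2 != 0) && (z.2 \in first_vars i.+1)) s
      & h = d i r + \sum_(z <- s) iota z.1%:MP * (d i z.2 / z.2)].
Proof.
(* The index [i] is left out because only the other derivatives act coefficientwise on polynomials
   in [x_i]. *)
move=> hi bi hb; pose I := {j : 'I_n | j != i}.
have dC (j : I) x : sub_partial i (sub_partial (sval j) x)
    = sub_partial (sval j) (sub_partial i x) :> subratfun i.+1.
  by apply: val_inj; apply: d_comm.
have dK (j : I) c : sub_partial (sval j) (const_subratfun i c) = 0.
  by apply: val_inj; rewrite /= d_iota mderivC rmorph0.
have d0 (x : subratfun i) :
    (forall j : I, sub_partial (sval j) x = 0) -> exists c, x = const_subratfun i c.
  by move=> dx; apply: sub_partial_eq0 => // j ji; apply: (dx (Sub j ji)).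
have hE (j : I) : exists b', sub_partial (sval j) (SubRatfun hi) = sub_partial i b'.
  by exists (SubRatfun (bi (sval j))); apply: val_inj; apply: hb.
have [r [s [s0 rsE]]] := @log_exact_of_delta_exact K (subratfun i)
  (subratfun i.+1) I (@const_subratfun i) (@subst_var i)
  (fun j : I => @sub_partial i (sval j)) (fun j : I => @sub_partial i.+1 (sval j))
  (@sub_partial i.+1 i) (pchar_subratfun i)
  (@subst_var_inj i) (@subst_var_frac i)
  (sub_partial_derivation _ _) (fun j : I => sub_partial_derivation _ (sval j))
  (fun j : I => sub_partial_derivation _ (sval j)) (@sub_partial_subst i)
  (fun (j : I) p => sub_partial_subst_neq p (svalP j)) dC dK d0 (SubRatfun hi) hE.
exists (ratfun_of r), [seq (z.1, ratfun_of z.2) | z <- s]; split.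
- exact: ratfun_ofP.
- rewrite all_map; apply: sub_all s0 => z /= z0; rewrite ratfun_ofP andbT.
  by apply: contraNneq z0 => z0; apply/eqP/val_inj.
- have /= -> := congr1 (@ratfun_of i.+1) rsE; congr (_ + _).
  rewrite (big_morph (@ratfun_of i.+1) (id1 := 0) (op1 := +%R)) // big_map.
  by apply: eq_bigr => z _ /=; rewrite /subst_var horner_morphC.
Qed.

(** The bound [k] limits both the variables in the coefficients and the differentials present, so an
    induction step removes [x_k] and [dx_k] together. *)
Lemma closed_form_log_exact k a : (k <= n)%N ->
    (forall i, a i \in first_vars k) -> (forall i, (k <= i)%N -> a i = 0) ->
    (forall i j, d i (a j) = d j (a i)) ->
  exists (r : F) (s : seq (K * F)),
    all (fun z => z.2 != 0) s /\
    forall i, a i = d i r + \sum_(z <- s) iota z.1%:MP * (d i z.2 / z.2).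
Proof.
elim: k a => [|k IHk] a kn ak a0 sym.
  by exists 0, [::]; split=> // i; rewrite big_nil addr0 a0 // (der0 (der_d i)).
pose i := Ordinal kn.
have [r [s [rk sk aiE]]] := @integrate_last_variable i (a i) a (ak i) ak (fun j => sym j i).
have s0 : all (fun z => z.2 != 0) s by apply: sub_all sk => z /andP[].
(* The form given by [r] and [s]: it is closed and has the same [i]-th coefficient as [a]. *)
pose w j := d j r + \sum_(z <- s) iota z.1%:MP * (d j z.2 / z.2).
have dP := der_d.
have wsym j l : d j (w l) = d l (w j).
  rewrite /w !(dP _).1 d_comm !(der_sum (dP _)) !big_seq; congr (_ + _).
  apply: eq_bigr => z /(allP s0) z0.
  rewrite !((dP _).2 (iota z.1%:MP)) !d_iota !mderivC rmorph0 !mul0r !add0r.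
  by congr (_ * _); exact: (der_logder (dP j) (dP l) z0 (d_comm j l z.2)).
have wk j : w j \in first_vars k.+1.
  apply: rpredD; first exact: partial_first_vars.
  rewrite big_seq; apply: rpred_sum => z /(allP sk) /andP[_ zk].
  by rewrite rpredM ?const_first_vars // rpred_div // partial_first_vars.
have w0 j : (k < j)%N -> w j = 0.
  move=> kj; rewrite /w (first_varsP _ _ rk) // add0r big_seq big1 // => z /(allP sk).
  by case/andP=> _ /first_varsP -> //; rewrite mul0r mulr0.
have bi : a i - w i = 0 by apply/eqP; rewrite subr_eq0 {1}aiE.
have [||||r' [s' [s'0 bE]]] := IHk (fun j => a j - w j).
- exact: ltnW.
(* The form [a - w] is closed with zero [i]-th coefficient, so its other coefficients have zero
   derivative in [x_i]. *)
- move=> j; apply/first_varsP => l; rewrite leq_eqVlt => /orP[/eqP kl|kl].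
    have -> : l = i by apply: val_inj.
    rewrite derB // sym wsym -derB // bi der0 //.
  by rewrite (first_varsP _ _ _ l kl) // rpredB.
- move=> j; rewrite leq_eqVlt => /orP[/eqP kj|kj].
    by have -> : j = i by apply: val_inj.
  by rewrite a0 // w0 // subr0.
- by move=> j l; rewrite !derB // sym wsym.
exists (r' + r), (s' ++ s); split; first by rewrite all_cat s'0.
by move=> j; rewrite (dP j).1 big_cat /= addrACA -bE subrK.
Qed.

End DifferentialField.

(** * Back to polynomials and differential forms *)

Lemma log_exact_polynomials (K : fieldType) (n : nat) (s : seq (K * ratfun K n)) :
    all (fun z => z.2 != 0) s ->
  exists t : seq (K * {mpoly K[n]}), all (fun z => z.2 != 0) t /\
    forall i, \sum_(z <- s) (z.1%:MP)%:F * (partial i z.2 / z.2)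
      = \sum_(z <- t) (z.1%:MP)%:F * ((z.2%:F)^-1 * partial i z.2%:F) :> ratfun K n.
Proof.
elim: s => [_|[c x] s IHs /= /andP[x0 /IHs[t [t0 tE]]]].
  by exists [::]; split=> // i; rewrite !big_nil.
have [p [q [q0 xE]]] := ratfunP x.
have p0 : p != 0 by apply: contraNneq x0 => p0; rewrite xE p0 tofrac0 mul0r.
(* The logarithmic derivative of [p / q] is the difference of those of [p] and [q]. *)
exists [:: (c, p), (- c, q) & t]; split=> [|i]; first by rewrite /= p0 q0.
rewrite !big_cons tE /= addrA; congr (_ + _).
have -> : partial i x / x = partial i p%:F / p%:F - partial i q%:F / q%:F.
  rewrite xE der_div; last by rewrite tofrac_eq0.
    move: (partial i p%:F) (partial i q%:F) => p' q'.
    by apply: quotient_rule_log; rewrite tofrac_eq0.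
  exact: partial_derivation.
rewrite mpolyCN tofracN mulrBr mulNr.
by rewrite ![_^-1 * _]mulrC.
Qed.

(** Passes from coordinates to combinations of basis vectors, and from the list [t] to a family
    indexed by an ordinal, as the theorem requires. *)
Lemma lin_comb_tnth (F : fieldType) (V : lmodType F) (I : finType) (T : Type)
    (t : seq T) (a b : I -> F) (u v : T -> F) (w : I -> T -> F) (e : I -> V) :
    (forall i, a i = b i + \sum_(z <- t) u z * (v z * w i z)) ->
  \sum_i a i *: e i = \sum_i b i *: e i
    + \sum_(k < size t) u (tnth (in_tuple t) k) *: (v (tnth (in_tuple t) k) *:
        \sum_i w i (tnth (in_tuple t) k) *: e i).
Proof.
move=> aE.
rewrite -(big_tnth _ _ t xpredT (fun z => u z *: (v z *: \sum_i w i z *: e i))).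
under [X in _ = _ + X]eq_bigr => z _ do rewrite !scaler_sumr.
rewrite exchange_big -big_split; apply: eq_bigr => i _ /=.
rewrite aE scalerDl scaler_suml; congr (_ + _).
by apply: eq_bigr => z _; rewrite !scalerA mulrA.
Qed.

Lemma form_log_exact (K : fieldType) (n : nat) (a : 'I_n -> ratfun K n)
    (r : ratfun K n) (t : seq (K * {mpoly K[n]})) :
    (forall i, a i = partial i r
      + \sum_(z <- t) (z.1%:MP)%:F * ((z.2%:F)^-1 * partial i z.2%:F)) ->
  \sum_(i < n) a i *: dx K i = extd (form0 r)
    + \sum_(k < size t) ((tnth (in_tuple t) k).1%:MP)%:F *:
        ((((tnth (in_tuple t) k).2)%:F)^-1 *: extd (form0 ((tnth (in_tuple t) k).2)%:F)).
Proof.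
move=> aE; rewrite extd_form0; under [X in _ + X]eq_bigr => k _ do rewrite extd_form0.
exact: (@lin_comb_tnth (ratfun K n) (dform K n) 'I_n
  (K * {mpoly K[n]})%type t a (fun i => partial i r) (fun z => (z.1%:MP)%:F)
  (fun z => (z.2%:F)^-1) (fun i z => partial i z.2%:F) (@dx K n) aE).
Qed.

Theorem theorem2 (R : realType) (n : nat) (n_ge1 : (1 <= n)%N)
    (a : 'I_n -> ratfun R[i] n) (alpha : dform R[i] n)
    (alphaE : alpha = \sum_(i < n) a i *: dx R[i] i)
    (alpha_closed : extd alpha = 0) :
  exists (g f : {mpoly R[i][n]}) (m : nat)
         (fs : 'I_m -> {mpoly R[i][n]}) (c : 'I_m -> R[i]),
    [/\ f != 0,
        (forall k : 'I_m, fs k != 0)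
      & alpha = extd (form0 (g%:F / f%:F))
                + \sum_(k < m)
                    ((c k)%:MP)%:F *: (((fs k)%:F)^-1 *: extd (form0 (fs k)%:F))].
Proof.
have sym : forall i j, partial i (a j) = partial j (a i).
  by apply/extd_form1_eq0; rewrite -alphaE.
have charC : [pchar R[i]] =i pred0 := @Num.Theory.pchar_num _.
have tofrac_inj : injective (@FracField.tofrac {mpoly R[i][n]}).
  by move=> p q /eqP; rewrite tofrac_eq => /eqP.
have [i|i|r [s [s0 aE]]] := @closed_form_log_exact R[i] n (ratfun R[i] n)
  (@FracField.tofrac _) (@partial _ _) charC
  tofrac_inj (@partial_derivation _ _) (@partial_comm _ _) (@partial_tofrac _ _)
  (@mderiv_minimal_fraction _ _) n a (leqnn n) _ _ sym.
(* At [k = n] both side conditions are vacuous, since no index reaches [n]. *)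
- by apply/first_varsP => j; rewrite leqNgt ltn_ord.
- by rewrite leqNgt ltn_ord.
have [g [f [f0 rE]]] := ratfunP r.
have [t [t0 tE]] := log_exact_polynomials s0.
exists g, f, (size t), (fun k => (tnth (in_tuple t) k).2), (fun k => (tnth (in_tuple t) k).1).
split=> // [k|]; first exact: (allP t0 _ (mem_tnth k (in_tuple t))).
rewrite -rE alphaE; apply: form_log_exact => i.
by rewrite aE tE.
Qed.
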